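(* Let $M$ be a base orderable matroid on a finite ground set $E$ with rank function $rk:2^E\to\mathbb{R}$. Then for any real $d\ge 0$, the polymatroid $(E,d\cdot rk)$ is a bidirectional flow polymatroid.
   Context: Base orderable matroids. A matroid with set of bases $\mathcal{B}$ is called base orderable if for every pair of bases $(B,B')$ there is a bijection $g_{B,B'}:B\to B'$ such that for all $e\in B$ both $(B\setminus\{e\})\cup\{g_{B,B'}(e)\}\in\mathcal{B}$ and $(B'\setminus\{g_{B,B'}(e)\})\cup\{e\}\in\mathcal{B}$. Polymatroids. Let $E$ be a finite set. If $\rho:2^E\to\mathbb{R}$ is submodular ($\rho(U)+\rho(V)\ge\rho(U\cup V)+\rho(U\cap V)$), monotone ($\rho(U)\le\rho(V)$ for $U\subseteq V$) and normalized ($\rho(\emptyset)=0$), then $(E,\rho)$ is called a polymatroid, with base polytope $$P_\rho=\{\vec x\in\mathbb{R}_{\ge0}^E : x(U)\le\rho(U)\ \forall U\subseteq E,\ x(E)=\rho(E)\},\qquad x(U):=\sum_{e\in U}x_e .$$ Bidirectional flow polymatroids. Let $\chi_e\in\mathbb{R}^E$ denote the unit vector of $e\in E$. For $\vec x,\vec y\in P_\rho$, let $D(\vec x,\vec y)$ be the capacitated directed graph with vertex set $E$ in which $(e,e')$ is an edge iff there is $\epsilon>0$ with $\vec x+\epsilon(\chi_{e'}-\chi_e)\in P_\rho$ and $\vec y+\epsilon(\chi_e-\chi_{e'})\in P_\rho$; the capacity of the edge $(e,e')$ is $$\hat c_{\vec x,\vec y}(e,e')=\max\{\alpha : \vec x+\alpha(\chi_{e'}-\chi_e)\in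 P_\rho \text{ and } \vec y+\alpha(\chi_e-\chi_{e'})\in P_\rho\}.$$ A bidirectional flow is a nonnegative flow in $D(\vec x,\vec y)$ respecting these capacities in which every $e$ with $x_e>y_e$ has supply $x_e-y_e$, every $e$ with $x_e<y_e$ has demand $y_e-x_e$, and flow is conserved at all other vertices (that is, outflow minus inflow at each $e\in E$ equals $x_e-y_e$). The polymatroid $(E,\rho)$ is called a bidirectional flow polymatroid if for every $\vec x,\vec y\in P_\rho$ there exists a bidirectional flow in $D(\vec x,\vec y)$. *)

(* Defs.v *)
From HB Require Import structures.
From mathcomp Require Import all_boot all_order all_algebra.
From mathcomp Require Import boolp classical_sets reals.

Set Implicit Arguments.
Unset Strict Implicit.
Unset Printing Implicit Defensive.

Import Order.TTheory GRing.Theory Num.Theory.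

Local Open Scope ring_scope.

(* {set E} is the type of finite sets over a finType E; set T is the type of
   classical (Prop-valued) sets over T. *)

Record matroid (E : finType) := Matroid {
  bases : {set {set E}};
  bases_nonempty : exists B : {set E}, B \in bases;
  bases_exchange : forall B B' : {set E}, B \in bases -> B' \in bases ->
    forall e, e \in B :\: B' ->
    exists2 f, f \in B' :\: B & f |: (B :\ e) \in bases
}.

Definition indep (E : finType) (M : matroid E) (I : {set E}) : bool :=
  [exists B in bases M, I \subset B].

Definition rank (E : finType) (M : matroid E) (U : {set E}) : nat :=
  (\max_(I : {set E} | indep M I && (I \subset U)) #|I|)%N.

(* A bijection B -> B' is a function on E, relevant only on B, that is
   injective on B and has image B'. *)
Definition base_orderable (E : finType) (M : matroid E) : Prop :=
  forall B B' : {set E}, B \in bases M -> B' \in bases M ->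
  exists g : E -> E,
    [/\ {in B &, injective g}, g @: B = B' &
        forall e, e \in B ->
          g e |: (B :\ e) \in bases M /\ e |: (B' :\ g e) \in bases M].

Definition polymatroid (R : realType) (E : finType) (rho : {set E} -> R) :
  Prop :=
  [/\ forall U V : {set E}, rho (U :|: V) + rho (U :&: V) <= rho U + rho V,
      forall U V : {set E}, U \subset V -> rho U <= rho V &
      rho finset.set0 = 0].

Definition base_polytope (R : realType) (E : finType) (rho : {set E} -> R) :
  set {ffun E -> R} :=
  fun x => [/\ forall e, 0 <= x e,
               forall U : {set E}, \sum_(e in U) x e <= rho U &
               \sum_e x e = rho finset.setT].

Definition chi (R : realType) (E : finType) (e : E) : {ffun E -> R} :=
  [ffun i => (i == e)%:R].

(* x + a (chi_e' - chi_e) *)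
Definition shift (R : realType) (E : finType) (x : {ffun E -> R}) (a : R)
  (e e' : E) : {ffun E -> R} :=
  [ffun i => x i + a * (chi R e' i - chi R e i)].

Definition feasible_steps (R : realType) (E : finType) (rho : {set E} -> R)
  (x y : {ffun E -> R}) (e e' : E) : set R :=
  fun a => base_polytope rho (shift x a e e') /\
           base_polytope rho (shift y a e' e).

Definition edge (R : realType) (E : finType) (rho : {set E} -> R)
  (x y : {ffun E -> R}) (e e' : E) : Prop :=
  exists2 eps : R, 0 < eps & feasible_steps rho x y e e' eps.

(* The maximum of the feasible steps. It exists whenever x and y lie in the
   base polytope and e != e'. For e = e' every step is feasible and there is no
   maximum; the default value 0 then forbids flow on the loop, which would not
   contribute to the net outflow anyway. *)
Definition capacity (R : realType) (E : finType) (rho : {set E} -> R)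
  (x y : {ffun E -> R}) (e e' : E) : R :=
  let A := feasible_steps rho x y e e' in xget 0 (A `&` ubound A)%classic.

Definition bidirectional_flow (R : realType) (E : finType)
  (rho : {set E} -> R) (x y : {ffun E -> R}) (f : E -> E -> R) : Prop :=
  [/\ forall e e', 0 <= f e e',
      forall e e', ~ edge rho x y e e' -> f e e' = 0,
      forall e e', edge rho x y e e' -> f e e' <= capacity rho x y e e' &
      forall e, \sum_e' f e e' - \sum_e' f e' e = x e - y e].

Definition bidirectional_flow_polymatroid (R : realType) (E : finType)
  (rho : {set E} -> R) : Prop :=
  polymatroid rho /\
  forall x y : {ffun E -> R}, base_polytope rho x -> base_polytope rho y ->
    exists f : E -> E -> R, bidirectional_flow rho x y f.

(* Main.v *)
(* A point of the base polytope of d * rk is d times a convex combination of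
   indicator vectors of bases (Edmonds): a point with a fractional coordinate
   can be moved both ways along a line, until more constraints become tight, and
   an integral point is the indicator vector of a base.  Writing x and y in
   this way with weights lam and mu, give the pair of bases (B, B') the weight
   lam B * mu B', and let every e in B send that weight, times d, to
   g_{B,B'} e.  The net outflow is x - y.  The flow from e to e' respects the
   capacity: pushing it in x (resp. back in y) exchanges e and e' in exactly
   those bases B (resp. B') whose pair has e' = g_{B,B'} e, so the result is
   again d times a convex combination of bases. *)
Require Import Defs.
From mathcomp Require Import all_boot all_order all_algebra.
From mathcomp Require Import boolp classical_sets reals.
From mathcomp Require Import fintype finset ring lra zify.
Import Order.TTheory GRing.Theory Num.Theory.
Local Open Scope ring_scope.

Set Implicit Arguments.
Unset Strict Implicit.
Unset Printing Implicit Defensive.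

(** * Bases and rank of a matroid *)

Section MatroidRank.
Variables (E : finType) (M : matroid E).
Implicit Types (B I U V W : {set E}).
Local Open Scope nat_scope.

Lemma exchange_card (B : {set E}) (e f : E) :
  e \in B -> f \notin B -> #|f |: (B :\ e)| = #|B|.
Proof.
move=> eB fB; rewrite cardsU1 in_setD1 (negbTE fB) andbF (cardsD1 e B) eB.
by [].
Qed.

(** An exchange keeps the size of [B] and shrinks [B :\: B']. Once this difference is empty, an
    element of [B' :\: B] would have nothing to be exchanged for, so the bases coincide. *)
Lemma card_bases B B' : B \in bases M -> B' \in bases M -> #|B| = #|B'|.
Proof.
move: {2}#|_| (leqnn #|B :\: B'|) => n.
elim: n B => [|n IHn] B leBn BM B'M.
  move: leBn; rewrite leqn0 cards_eq0 => /eqP BB'.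
  suff -> : B = B' by [].
  apply/eqP; rewrite eqEsubset -!setD_eq0 BB' eqxx /=.
  apply/eqP/setP => e; rewrite in_set0; apply/negP => eB'B.
  have [f] := bases_exchange B'M BM eB'B.
  by rewrite BB' in_set0.
have [BB'|/set0Pn[e eBB']] := eqVneq (B :\: B') set0.
  by apply: IHn => //; rewrite BB' cards0.
have [f fB'B fBM] := bases_exchange BM B'M eBB'.
move: (eBB') (fB'B); rewrite !inE => /andP[eB' eB] /andP[fB fB'].
rewrite -(exchange_card eB fB); apply: IHn => //.
rewrite -ltnS (leq_trans _ leBn) //; apply: proper_card.
apply/properP; split.
  apply/subsetP => i; rewrite !inE => /andP[iB' /orP[/eqP ifE|/andP[_ ->]]].
    by rewrite ifE fB' in iB'.
  by rewrite iB'.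
by exists e => //; rewrite !inE eqxx /= orbF eB' /=; apply: contraNneq fB => <-.
Qed.

(** If [f] were in [B], the new base would be [B :\ e], one element too small. *)
Lemma swap_notin B e f : B \in bases M -> e \in B -> e != f ->
  f |: (B :\ e) \in bases M -> f \notin B.
Proof.
move=> BM eB ef fBM; apply/negP => fB.
have := card_bases fBM BM.
by rewrite cardsU1 in_setD1 eq_sym ef fB (cardsD1 e B) eB; lia.
Qed.

Lemma card_le_rank I U : indep M I -> I \subset U -> #|I| <= rank M U.
Proof.
by move=> iI IU; apply: (leq_bigmax_cond (P := fun I => _ && _)); rewrite iI.
Qed.

Lemma indep_sub_base I B : B \in bases M -> I \subset B -> indep M I.
Proof. by move=> BM IB; apply/existsP; exists B; rewrite BM. Qed.

Lemma card_baseI_le_rank B U : B \in bases M -> #|B :&: U| <= rank M U.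
Proof.
move=> BM; apply: card_le_rank (subsetIr _ _).
exact: indep_sub_base BM (subsetIl _ _).
Qed.

Lemma rank_witness U :
  exists I, [/\ indep M I, I \subset U & #|I| = rank M U].
Proof.
have [B BM] := bases_nonempty M.
have i0 : indep M set0 && (set0 \subset U).
  by rewrite (indep_sub_base BM) ?sub0set.
rewrite /rank (bigop.bigmax_eq_arg set0) //.
by case: arg_maxnP => // I /andP[iI IU] _; exists I.
Qed.

Lemma rank_le_card U : rank M U <= #|U|.
Proof. by have [I [_ IU <-]] := rank_witness U; exact: subset_leq_card. Qed.

Lemma rank_setT B : B \in bases M -> rank M setT = #|B|.
Proof.
move=> BM; apply/eqP; rewrite eqn_leq; apply/andP; split.
  have [I [/existsP[B0 /andP[B0M IB0]] _ <-]] := rank_witness setT.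
  by rewrite (card_bases BM B0M) subset_leq_card.
by rewrite card_le_rank ?subsetT // (indep_sub_base BM).
Qed.

Lemma baseP B : rank M B = #|B| -> rank M setT = #|B| -> B \in bases M.
Proof.
move=> rB rT; have [I [iI IB cI]] := rank_witness B.
have IE : I = B by apply/eqP; rewrite eqEcard IB cI rB /=.
move: iI; rewrite IE => /existsP[B0 /andP[B0M BB0]].
suff -> : B = B0 by [].
by apply/eqP; rewrite eqEcard BB0 -(rank_setT B0M) rT /=.
Qed.

(* Take a base B containing I that is as close as possible to a base B0 meeting
   W in rank W elements; an element of B outside W and B0 could be exchanged
   for one of B0. *)
Lemma base_extension I W : indep M I -> I \subset W ->
  exists2 B, B \in bases M & I \subset B /\ #|B :&: W| = rank M W.
Proof.
move=> /existsP[B1 B1P] IW.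
have [J [/existsP[B0 /andP[B0M JB0]] JW cJ]] := rank_witness W.
case: (@arg_maxnP _ B1 (fun B => (B \in bases M) && (I \subset B))
  (fun B => #|B :&: B0|) B1P) => B /andP[BM IB] Bmax.
exists B => //; split=> //; apply/eqP; rewrite eqn_leq card_baseI_le_rank //=.
rewrite leqNgt; apply/negP => ltB.
have leJ : #|J| <= #|B0 :&: W| by rewrite subset_leq_card // subsetI JB0.
(* The bases [B] and [B0] have the same size and [B] has fewer elements in [W], so it has more
   elements outside [W]. *)
have : ~~ (B :\: W \subset B0 :\: W).
  apply/negP => /subset_leq_card.
  have := card_bases BM B0M; rewrite -(cardsID W B) -(cardsID W B0).
  by lia.
case/subsetPn => e; rewrite !inE => /andP[eW eB]; rewrite eW /= => eB0.
have [|f] := @bases_exchange _ M B B0 BM B0M e; first by rewrite inE eB0 eB.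
rewrite inE => /andP[fB fB0] fBM.
have := Bmax (f |: (B :\ e)); rewrite fBM /=.
have -> : I \subset f |: (B :\ e).
  apply/subsetP => i iI; rewrite !inE (subsetP IB) // andbT.
  by rewrite (_ : i != e) ?orbT //; apply: contraNneq eW => <-; exact: (subsetP IW).
move=> /(_ isT); rewrite leqNgt => /negP; apply; apply: proper_card.
apply/properP; split.
  apply/subsetP => i; rewrite !inE => /andP[iB iB0]; rewrite iB iB0 !andbT.
  by rewrite (_ : i != e) ?orbT //; apply: contraNneq eB0 => <-.
by exists f; rewrite !inE ?eqxx ?fB0 // (negbTE fB).
Qed.

(** A largest independent subset of [U :&: V] extends to a base [B] meeting [U :|: V] in full rank.
    Counting [B :&: U] and [B :&: V] gives the inequality. *)
Lemma rank_submod U V :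
  rank M (U :|: V) + rank M (U :&: V) <= rank M U + rank M V.
Proof.
have [I [iI IUV <-]] := rank_witness (U :&: V).
have IW : I \subset U :|: V.
  exact: subset_trans IUV (subset_trans (subsetIl _ _) (subsetUl _ _)).
have [B BM [IB <-]] := base_extension iI IW.
rewrite setIUr.
have := cardsUI (B :&: U) (B :&: V).
rewrite -setIIr.
have := card_baseI_le_rank U BM; have := card_baseI_le_rank V BM.
have : #|I| <= #|B :&: (U :&: V)| by rewrite subset_leq_card // subsetI IB.
by lia.
Qed.

Lemma rank_mono U V : U \subset V -> rank M U <= rank M V.
Proof.
move=> UV; have [I [iI IU <-]] := rank_witness U.
by rewrite card_le_rank // (subset_trans IU).
Qed.

End MatroidRank.

(** * Steps along a line in a base polytope, and capacities *)

Section BasePolytope.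
Variables (R : realType) (E : finType).
Implicit Types (x y z : {ffun E -> R}) (U V : {set E}) (rho : {set E} -> R).

Lemma sum_indicator U (e : E) : \sum_(i in U) (i == e)%:R = (e \in U)%:R :> R.
Proof.
rewrite (eq_bigr (fun i => if i == e then 1 else 0)); last by move=> i _; case: eqP.
rewrite -big_mkcondr /=; have [eU|eU] := boolP (e \in U).
  by rewrite (big_pred1 e) // => i; rewrite andbC /=; case: eqP => // ->.
by rewrite big1 // => i /andP[iU /eqP ie]; rewrite ie (negbTE eU) in iU.
Qed.

Lemma sum_shift x (a : R) (e f : E) U :
  \sum_(i in U) shift x a e f i =
  \sum_(i in U) x i + a * ((f \in U)%:R - (e \in U)%:R).
Proof.
under eq_bigr do rewrite ffunE.
rewrite big_split /= -mulr_sumr; congr (_ + _ * _).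
rewrite sumrB; congr (_ - _); rewrite -sum_indicator; apply: eq_bigr => i _.
  by rewrite ffunE.
by rewrite ffunE.
Qed.

Lemma sum_setT x : \sum_e x e = \sum_(e in setT) x e.
Proof. by apply: eq_bigl => e; rewrite in_setT. Qed.

(** Affine inequalities pass to the supremum: this replaces a closedness argument for the
    polytope. *)
Lemma sup_lin_le (A : set R) (u c v : R) : has_sup A ->
  (forall a, A a -> u + a * c <= v) -> u + sup A * c <= v.
Proof.
move=> supA le_v; have [[a0 Aa0] ubA] := supA.
have [c0|c0|c0] := ltgtP c 0; last 1 first.
- by have := le_v _ Aa0; rewrite c0 !mulr0.
- apply: le_trans (le_v _ Aa0); rewrite lerD2l ler_nM2r //.
  by apply: ub_le_sup.
- rewrite -lerBrDl -ler_pdivlMr //; apply: ge_sup; first by exists a0.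
  by move=> a Aa; rewrite ler_pdivlMr // lerBrDl le_v.
Qed.

(** The feasible steps are bounded by [x e], since coordinate [e] must stay nonnegative. All
    constraints are affine in the step, so the supremum is feasible: the maximum exists and [xget]
    does not return its default. *)
Lemma capacity_ge rho x y (e f : E) a : e != f ->
  feasible_steps rho x y e f a -> a <= capacity rho x y e f.
Proof.
move=> ef Aa; rewrite /capacity.
set A := feasible_steps rho x y e f.
have ubA : ubound A (x e).
  move=> b [[/(_ e) + _ _] _].
  by rewrite !ffunE eqxx (negbTE ef) /=; lra.
have supA : has_sup A by split; [exists a | exists (x e)].
case: xgetP => [b _ [_ /(_ a Aa)] //|/(_ (sup A)) noMax].
case: noMax; split; last by apply: ub_le_sup; exists (x e).
have cl z (i j : E) : (forall b, A b -> base_polytope rho (shift z b i j)) ->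
    base_polytope rho (shift z (sup A) i j).
  move=> Pz; split.
  - move=> k; rewrite ffunE -oppr_le0 opprD -mulrN.
    by apply: sup_lin_le => // b /Pz[/(_ k) + _ _]; rewrite ffunE; lra.
  - move=> U; rewrite sum_shift; apply: sup_lin_le => // b /Pz[_ /(_ U) + _].
    by rewrite sum_shift.
  - have [_ _] := Pz _ Aa; rewrite !sum_setT !sum_shift !in_setT; lra.
by split; apply: cl => b [].
Qed.

End BasePolytope.

(** * Points of the scaled base polytope as convex combinations of bases *)

Section Integrality.
Variables (R : realType) (E : finType) (M : matroid E).
Implicit Types (x y z : {ffun E -> R}) (U V : {set E}).

Let rk U : R := (rank M U)%:R.

Definition base_hull x : Prop :=
  exists lam : {set E} -> R,
    [/\ forall B, 0 <= lam B, forall B, lam B != 0 -> B \in bases M,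
        \sum_B lam B = 1 & forall e, x e = \sum_B lam B * (e \in B)%:R].

Lemma base_hull_convex x y z (t : R) : 0 <= t <= 1 ->
  base_hull x -> base_hull y -> (forall e, z e = t * x e + (1 - t) * y e) ->
  base_hull z.
Proof.
move=> /andP[t0 t1] [l [l0 lB l1 lx]] [m [m0 mB m1 my]] zE.
exists (fun B => t * l B + (1 - t) * m B); split.
- by move=> B; rewrite addr_ge0 // mulr_ge0 // subr_ge0.
- move=> B; have [lB0|/lB //] := eqVneq (l B) 0.
  by have [mB0|/mB //] := eqVneq (m B) 0; rewrite lB0 mB0 !mulr0 addr0 eqxx.
- by rewrite big_split -!mulr_sumr l1 m1 /=; ring.
- move=> e; rewrite zE lx my !mulr_sumr -big_split; apply: eq_bigr => B _ /=.
  ring.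
Qed.

Lemma base_hull_base (B : {set E}) : B \in bases M ->
  base_hull [ffun e => (e \in B)%:R].
Proof.
move=> BM; exists (fun C => (C == B)%:R); split.
- by move=> C; rewrite ler0n.
- by move=> C; have [->|] := eqVneq C B; rewrite ?eqxx.
- by rewrite (bigD1 B) //= eqxx big1 ?addr0 // => C /negbTE ->.
- move=> e; rewrite ffunE (bigD1 B) //= eqxx mul1r big1 ?addr0 // => C /negbTE ->.
  by rewrite mul0r.
Qed.

(** Together with [tight], this collects the constraints that hold with equality; their total number
    measures progress towards an integral point. *)
Definition zeros x : {set E} := [set e | x e == 0].
Definition tight x : {set {set E}} := [set U : {set E} | \sum_(e in U) x e == rk U].

(** Uncrossing: the sum of [x] over a set is modular and [rk] is submodular, so tightness of [U] and
    [V] leaves no slack at their union or intersection. *)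
Lemma tight_setI x U V : base_polytope rk x ->
  U \in tight x -> V \in tight x -> U :&: V \in tight x.
Proof.
move=> [_ xr _]; rewrite !inE => /eqP tU /eqP tV.
have xUV : \sum_(e in U :|: V) x e + \sum_(e in U :&: V) x e =
           \sum_(e in U) x e + \sum_(e in V) x e.
  have sE W : \sum_(e in W) x e = \sum_e (e \in W)%:R * x e.
    rewrite big_mkcond; apply: eq_bigr => e _.
    by case: (e \in W); rewrite ?mul1r ?mul0r.
  rewrite !sE -!big_split; apply: eq_bigr => e _ /=; rewrite !inE.
  by case: (e \in U); case: (e \in V) => /=; ring.
rewrite eq_le xr /=.
have sub : rk (U :|: V) + rk (U :&: V) <= rk U + rk V.
  by rewrite /rk -!natrD ler_nat rank_submod.
by have := xr (U :|: V); lra.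
Qed.

(** Only nonnegativity at [e] and the sets containing [f] but not [e] can block the move. The step
    [a] is the smaller of [x e] and the least slack [m] of those sets, positive because no tight set
    separates [e] from [f]. Old equalities persist, and the blocking constraint becomes a new
    one. *)
Lemma shift_tight x (e f : E) : base_polytope rk x -> 0 < x e -> 0 < x f ->
  e != f -> (forall U, U \in tight x -> (e \in U) = (f \in U)) ->
  exists2 a, 0 < a & base_polytope rk (shift x a e f) /\
    (#|zeros x| + #|tight x| <
     #|zeros (shift x a e f)| + #|tight (shift x a e f)|)%N.
Proof.
move=> [x0 xr xT] e0 f0 ef sep.
pose P U := (f \in U) && (e \notin U).
have P1 : P [set f] by rewrite /P !inE eqxx ef.
case: (@Order.TotalTheory.arg_minP _ _ _ _ P (fun U => rk U - \sum_(i in U) x i) P1)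
  => U0 /andP[fU0 eU0] minU0.
set m := rk U0 - _ in minU0.
have m0 : 0 < m.
  rewrite subr_gt0 lt_neqAle xr andbT; apply/negP => tU0.
  have U0t : U0 \in tight x by rewrite inE.
  by move: eU0; rewrite (sep _ U0t) fU0.
have zE : forall a i, shift x a e f i =
    x i + a * ((i == f)%:R - (i == e)%:R) by move=> a i; rewrite !ffunE.
pose a := Num.min (x e) m; have a0 : 0 < a by rewrite lt_min e0.
have ae : a <= x e by rewrite ge_min lexx.
have am : a <= m by rewrite ge_min lexx orbT.
exists a => //.
have subz : zeros x \subset zeros (shift x a e f).
  apply/subsetP => i; rewrite !inE zE => /eqP xi0.
  have /negbTE -> : i != f by apply: contraTneq f0 => <-; rewrite xi0 ltxx.
  have /negbTE -> : i != e by apply: contraTneq e0 => <-; rewrite xi0 ltxx.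
  by rewrite xi0; apply/eqP; ring.
have subt : tight x \subset tight (shift x a e f).
  apply/subsetP => U Ut; move: (Ut); rewrite !inE sum_shift (sep U Ut).
  by rewrite subrr mulr0 addr0.
split; first split.
- move=> i; rewrite zE; case: (eqVneq i e) => [->|_].
    by rewrite (negbTE ef) /=; lra.
  by have := x0 i; case: (i == f) => /=; lra.
- move=> U; rewrite sum_shift; have := xr U; have := minU0 U; rewrite /P.
  case: (f \in U); case: (e \in U) => /=; [lra| |lra|lra].
  by move=> /(_ isT); lra.
- by rewrite -xT !sum_setT sum_shift !in_setT subrr mulr0 addr0.
have [xem|mxe] := leP (x e) m.
- have aE : a = x e by rewrite /a min_l.
  rewrite -addSn leq_add ?subset_leq_card //; apply: proper_card.
  apply/properP; split=> //; exists e.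
    by rewrite !inE zE eqxx (negbTE ef) aE; apply/eqP => /=; ring.
  by rewrite inE gt_eqF.
- have aE : a = m by rewrite /a min_r // ltW.
  rewrite -addnS leq_add ?subset_leq_card //; apply: proper_card.
  apply/properP; split=> //; exists U0.
    rewrite inE sum_shift fU0 (negbTE eU0) aE /m; apply/eqP => /=; ring.
  by rewrite inE lt_eqF // -subr_gt0.
Qed.

(* Inside a tight set minimal among those containing a fractional coordinate,
   the sum is an integer, so there are two fractional coordinates; no tight set
   separates them, so x can be moved both ways along their difference. *)
Lemma fractional_pair x (e0 : E) : base_polytope rk x -> 0 < x e0 < 1 ->
  exists e f : E, [/\ e != f, 0 < x e, 0 < x f &
    forall U, U \in tight x -> (e \in U) = (f \in U)].
Proof.
move=> Px fr0; have [x0 xr xT] := Px.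
pose P U := (U \in tight x) && [exists e in U, 0 < x e < 1].
have PT : P setT.
  rewrite /P inE -sum_setT xT eqxx /=; apply/existsP; exists e0.
  by rewrite in_setT.
case: (@arg_minnP _ _ P (fun U => #|U|) PT) => D /andP[Dt /existsP[e /andP[eD fe]]] Dmin.
have x1 i : x i <= 1.
  have := xr [set i]; rewrite big_set1 => /le_trans; apply.
  by rewrite /rk -[1]/(1%:R) ler_nat (leq_trans (rank_le_card _ _)) ?cards1.
have [f [fD ff fe']] : exists f, [/\ f \in D, 0 < x f < 1 & f != e].
  apply/not_existsP => nof.
  have int i : i \in D :\ e -> x i = (x i == 1)%:R.
    rewrite !inE => /andP[ie iD]; case: eqP => [->//|/eqP xi1].
    apply/eqP; rewrite eq_le x0 andbT leNgt; apply/negP => xi0.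
    by apply: (nof i); split=> //; rewrite xi0 lt_neqAle xi1 x1.
  move: Dt; rewrite inE (big_setD1 e) //= (eq_bigr _ int) -natr_sum /rk.
  case/andP: fe => e_gt0 e_lt1 /eqP xeE.
  set n := (\sum_(_ in _) _)%N in xeE; set m := rank _ _ in xeE.
  have nm : (n < m)%N by rewrite -(ltr_nat R); lra.
  have mn : (m < n.+1)%N by rewrite -(ltr_nat R) -natr1; lra.
  by lia.
(* If [U] contained [i] but not [j], then [D :&: U] would be a smaller tight set with a fractional
   coordinate. *)
have nosep i j U : i \in D -> 0 < x i < 1 -> j \in D -> U \in tight x ->
    i \in U -> j \in U.
  move=> iD fi jD Ut iU; apply/negPn/negP => jU.
  have := Dmin (D :&: U); rewrite /P tight_setI //=.
  have -> : [exists k in D :&: U, 0 < x k < 1].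
    by apply/existsP; exists i; rewrite !inE iD iU.
  move=> /(_ isT); rewrite leqNgt => /negP; apply; apply: proper_card.
  by apply/properP; split; [exact: subsetIl|exists j => //; rewrite !inE jD].
exists e, f; rewrite eq_sym; split=> //; [by case/andP: fe|by case/andP: ff|].
by move=> U Ut; apply/idP/idP; [apply: (nosep e f)|apply: (nosep f e)].
Qed.

(** Singletons have rank at most 1, so [x] is the indicator of a set [B]. The constraint at [B]
    gives it rank [#|B|], and the total sum makes this the full rank. *)
Lemma integral_hull x : base_polytope rk x -> (forall e, ~ 0 < x e < 1) ->
  base_hull x.
Proof.
move=> [x0 xr xT] nofr.
have int i : x i = (x i == 1)%:R.
  case: eqP => [->//|/eqP xi1]; apply/eqP; rewrite eq_le x0 andbT leNgt.
  apply/negP => xi0; apply: (nofr i); rewrite xi0 lt_neqAle xi1 /=.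
  have := xr [set i]; rewrite big_set1 => /le_trans; apply.
  by rewrite /rk -[leRHS]/(1%:R) ler_nat (leq_trans (rank_le_card _ _)) ?cards1.
pose B := [set i | x i == 1].
have xB : x = [ffun e => (e \in B)%:R] by apply/ffunP => i; rewrite ffunE inE -int.
have cB : \sum_e x e = #|B|%:R.
  rewrite xB -sum1_card natr_sum [RHS]big_mkcond /=; apply: eq_bigr => i _.
  by rewrite ffunE; case: (i \in B).
have sB : \sum_(e in B) x e = #|B|%:R.
  rewrite -sum1_card natr_sum; apply: eq_bigr => i iB.
  by rewrite xB ffunE iB.
have rT : rank M setT = #|B|.
  by apply/eqP; rewrite -(eqr_nat R) -cB xT.
have rB : rank M B = #|B|.
  apply/eqP; rewrite eqn_leq rank_le_card -(ler_nat R) -sB; exact: xr.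
rewrite xB; exact/base_hull_base/baseP.
Qed.

(** Induction on the number of constraints not yet equalities: a fractional point lies on a segment
    between two points with fewer of them. *)
Lemma base_polytope_hull x : base_polytope rk x -> base_hull x.
Proof.
pose mu x := (#|zeros x| + #|tight x|)%N.
have mu_max z : (mu z <= #|E| + #|{set E}|)%N by rewrite leq_add ?max_card.
have [n] := ubnP (#|E| + #|{set E}| - mu x)%N.
elim: n x => // n IHn x leN Px.
have [[e0 fe0]|nofr] := pselect (exists e, 0 < x e < 1); last first.
  by apply: integral_hull => // e fe; apply: nofr; exists e.
have [e [f [ef xe xf sep]]] := fractional_pair Px fe0.
have [a a0 [Pa mua]] := shift_tight Px xe xf ef sep.
have fe : f != e by rewrite eq_sym.
have [b b0 [Pb mub]] := shift_tight Px xf xe fe (fun U Ut => esym (sep U Ut)).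
have IH z : base_polytope rk z -> (mu x < mu z)%N -> base_hull z.
  by move=> Pz muz; apply: IHn => //; have := mu_max z; lia.
have ab0 : a + b != 0 by rewrite gt_eqF ?addr_gt0.
(* The moves by [a] and by [b] go in opposite directions and cancel under the weights [b / (a + b)]
   and [a / (a + b)]. *)
apply: (@base_hull_convex _ _ x (b / (a + b)) _ (IH _ Pa mua) (IH _ Pb mub)).
  rewrite ler_pdivrMr ?addr_gt0 // mul1r lerDr (ltW a0) andbT.
  by rewrite divr_ge0 // ltW // addr_gt0.
by move=> i; rewrite !ffunE; field.
Qed.

Lemma scaled_base_polytope_hull x (d : R) : 0 <= d ->
  base_polytope (fun U => d * rk U) x ->
  exists2 z, base_hull z & forall e, x e = d * z e.
Proof.
rewrite le_eqVlt => /orP[/eqP <- [x0 xr _]|d0 [x0 xr xT]].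
  (* For [d] equal to 0 rescaling is impossible, but the polytope is just the origin and any base
     serves. *)
  have [B BM] := bases_nonempty M; exists [ffun e => (e \in B)%:R].
    exact: base_hull_base.
  move=> e; rewrite mul0r; apply/eqP; rewrite eq_le x0 andbT.
  by have := xr [set e]; rewrite big_set1 mul0r.
exists [ffun e => d^-1 * x e]; last first.
  by move=> e; rewrite ffunE mulrA divff ?mul1r ?gt_eqF.
have sE U : \sum_(e in U) [ffun e => d^-1 * x e] e = d^-1 * \sum_(e in U) x e.
  by rewrite mulr_sumr; apply: eq_bigr => e _; rewrite ffunE.
apply: base_polytope_hull; split.
- by move=> e; rewrite ffunE mulr_ge0 // invr_ge0 ltW.
- by move=> U; rewrite sE ler_pdivrMl.
- by rewrite sum_setT sE -sum_setT xT mulrA mulVf ?mul1r ?gt_eqF.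
Qed.

(** Each base meets [U] in at most [rank M U] elements, with equality for the ground set. An
    arbitrary index type allows combinations indexed by pairs of bases, with repetitions. *)
Lemma hull_base_polytope (I : finType) (w : I -> R) (C : I -> {set E}) (d : R) z :
  0 <= d -> (forall p, 0 <= w p) -> (forall p, w p != 0 -> C p \in bases M) ->
  \sum_p w p = 1 -> (forall e, z e = d * \sum_p w p * (e \in C p)%:R) ->
  base_polytope (fun U => d * rk U) z.
Proof.
move=> d0 w0 wC w1 zE.
have sE U : \sum_(e in U) z e = d * \sum_p w p * #|C p :&: U|%:R.
  rewrite (eq_bigr _ (fun e _ => zE e)) -mulr_sumr exchange_big /=; congr (_ * _).
  apply: eq_bigr => p _; rewrite -mulr_sumr; congr (_ * _).
  rewrite -sum1_card natr_sum /= big_mkcond [RHS]big_mkcond /=.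
  by apply: eq_bigr => e _; rewrite inE andbC; case: (e \in U); case: (e \in C p).
have rkE U : rk U = \sum_p w p * rk U by rewrite -mulr_suml w1 mul1r.
split.
- by move=> e; rewrite zE mulr_ge0 // sumr_ge0 // => p _; rewrite mulr_ge0 ?ler0n.
- move=> U; rewrite sE ler_wpM2l // rkE ler_sum // => p _.
  have [->|/wC CM] := eqVneq (w p) 0; first by rewrite !mul0r.
  by rewrite ler_wpM2l // /rk ler_nat card_baseI_le_rank.
- rewrite sum_setT sE; congr (_ * _); rewrite [RHS]rkE.
  apply: eq_bigr => p _; have [->|/wC CM] := eqVneq (w p) 0; first by rewrite !mul0r.
  by rewrite setIT /rk (rank_setT CM).
Qed.

(** Summing out [mu] leaves the marginal [lam], whichever component of the pair it weighs. *)
Lemma coupling_marginals (lam mu : {set E} -> R) (h : {set E} -> R) :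
  \sum_B mu B = 1 ->
  \sum_(p : {set E} * {set E}) lam p.1 * mu p.2 * h p.1 = \sum_B lam B * h B /\
  \sum_(p : {set E} * {set E}) mu p.1 * lam p.2 * h p.2 = \sum_B lam B * h B.
Proof.
move=> mu1; split.
  rewrite -(pair_big predT predT (fun B C => lam B * mu C * h B)) /=.
  apply: eq_bigr => B _; rewrite -mulr_suml -mulr_sumr mu1; ring.
rewrite -(pair_big predT predT (fun B C => mu B * lam C * h C)) /= exchange_big /=.
by apply: eq_bigr => B _; rewrite -!mulr_suml mu1; ring.
Qed.

End Integrality.

(** * The scaled rank polymatroid and its bidirectional flows *)

Lemma rank_polymatroid (R : realType) (E : finType) (M : matroid E) (d : R) :
  0 <= d -> polymatroid (fun U : {set E} => d * (rank M U)%:R).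
Proof.
move=> d0; split.
- by move=> U V; rewrite -!mulrDr -!natrD ler_wpM2l // ler_nat rank_submod.
- by move=> U V UV; rewrite ler_wpM2l // ler_nat rank_mono.
- have := rank_le_card M set0.
  by rewrite cards0 leqn0 => /eqP ->; rewrite mulr0.
Qed.

Theorem theorem5p2 (R : realType) (E : finType) (M : matroid E) (d : R) :
  base_orderable M -> 0 <= d ->
  bidirectional_flow_polymatroid (fun U : {set E} => d * (rank M U)%:R).
Proof.
move=> boM d0; split; first exact: rank_polymatroid.
move=> x y Px Py.
have [x' [lam [lam0 lamM lam1 lamx]] xE] := scaled_base_polytope_hull d0 Px.
have [y' [mu [mu0 muM mu1 muy]] yE] := scaled_base_polytope_hull d0 Py.
pose pairT := ({set E} * {set E})%type.
(* One bijection is fixed for each pair of bases. Other pairs get the identity, and their weight [w]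
   is 0. *)
have /choice[g gP] : forall p : pairT, exists g : E -> E,
    p.1 \in bases M -> p.2 \in bases M ->
    [/\ {in p.1 &, injective g}, g @: p.1 = p.2 &
      forall e, e \in p.1 -> g e |: (p.1 :\ e) \in bases M /\
                             e |: (p.2 :\ g e) \in bases M].
  move=> p; have [p1|p1] := boolP (p.1 \in bases M); last by exists id.
  have [p2|p2] := boolP (p.2 \in bases M); last by exists id.
  by have [g gP] := boM _ _ p1 p2; exists g.
pose w (p : pairT) := lam p.1 * mu p.2.
have w0 p : 0 <= w p by rewrite mulr_ge0.
have wM p : w p != 0 -> p.1 \in bases M /\ p.2 \in bases M.
  by rewrite mulf_eq0 negb_or => /andP[/lamM ? /muM].
have w1 : \sum_p w p = 1.
  have [+ _] := coupling_marginals lam (fun=> 1) mu1.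
  under eq_bigr do rewrite mulr1.
  by under [in X in _ = X -> _]eq_bigr do rewrite mulr1; rewrite lam1.
have xw e : x e = d * \sum_p w p * (e \in p.1)%:R.
  rewrite xE lamx; congr (_ * _).
  by have [<- _] := coupling_marginals lam (fun B => (e \in B)%:R) mu1.
have yw e : y e = d * \sum_p w p * (e \in p.2)%:R.
  rewrite yE muy; congr (_ * _).
  by have [_ <-] := coupling_marginals mu (fun B => (e \in B)%:R) lam1.
pose moved (p : pairT) e e' := (e \in p.1) && (g p e == e').
pose f0 e e' := d * \sum_p w p * (moved p e e')%:R.
(* Elements fixed by [g p] would send flow along a loop, where the capacity defaults to 0; dropping
   it does not change the net outflow. *)
pose f e e' := if e == e' then 0 else f0 e e'.
have f0_ge0 e e' : 0 <= f0 e e'.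
  by rewrite mulr_ge0 // sumr_ge0 // => p _; rewrite mulr_ge0 ?ler0n.
have feas e e' : e != e' -> feasible_steps
    (fun U : {set E} => d * (rank M U)%:R) x y e e' (f0 e e').
  move=> ee'; split.
  - apply: (@hull_base_polytope R E M _ w (fun p =>
      if moved p e e' then e' |: (p.1 :\ e) else p.1)) => // [p wp|i].
      have [p1 p2] := wM p wp; case: ifP => // /andP[ep /eqP <-].
      by have [_ _ /(_ e ep)[]] := gP p p1 p2.
    rewrite !ffunE xw -mulrA -mulrDr mulr_suml -big_split; congr (_ * _).
    apply: eq_bigr => p _ /=; have [->|wp] := eqVneq (w p) 0; first by rewrite !mul0r addr0.
    rewrite -mulrA -mulrDr; congr (_ * _).
    case: ifPn => [/andP[ep /eqP ge]|_]; last by rewrite mul0r addr0.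
    have [p1 p2] := wM p wp; have [_ _ /(_ e ep)[]] := gP p p1 p2.
    (* Since [e'] is not in [p.1], the exchange changes the indicator vector by exactly
       [chi R e' - chi R e]. *)
    rewrite ge => /(swap_notin p1 ep ee') e'p _; rewrite mul1r !inE.
    have [->|ie'] := eqVneq i e'; first by rewrite eq_sym (negbTE ee') (negbTE e'p) /=; ring.
    by have [->|ie] := eqVneq i e; rewrite /= ?ep /=; ring.
  - apply: (@hull_base_polytope R E M _ w (fun p =>
      if moved p e e' then e |: (p.2 :\ e') else p.2)) => // [p wp|i].
      have [p1 p2] := wM p wp; case: ifP => // /andP[ep /eqP <-].
      by have [_ _ /(_ e ep)[]] := gP p p1 p2.
    rewrite !ffunE yw -mulrA -mulrDr mulr_suml -big_split; congr (_ * _).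
    apply: eq_bigr => p _ /=; have [->|wp] := eqVneq (w p) 0; first by rewrite !mul0r addr0.
    rewrite -mulrA -mulrDr; congr (_ * _).
    case: ifPn => [/andP[ep /eqP ge]|_]; last by rewrite mul0r addr0.
    have [p1 p2] := wM p wp; have [_ im /(_ e ep)[]] := gP p p1 p2.
    have e'p : e' \in p.2 by rewrite -im -ge imset_f.
    have e'e : e' != e by rewrite eq_sym.
    rewrite ge => _ /(swap_notin p2 e'p e'e) ep2; rewrite mul1r !inE.
    have [->|ie'] := eqVneq i e; first by rewrite (negbTE ee') (negbTE ep2) /=; ring.
    by have [->|ie] := eqVneq i e'; rewrite /= ?e'p /=; ring.
exists f; split.
- by move=> e e'; rewrite /f; case: ifP.
- move=> e e' noE; rewrite /f; case: eqVneq => // ee'.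
  apply/eqP; rewrite eq_le f0_ge0 andbT leNgt; apply/negP => f_gt0.
  by apply: noE; exists (f0 e e') => //; exact: feas.
- move=> e e' [eps eps0 Aeps]; rewrite /f; case: eqVneq => [ee'|ee']; last first.
    exact/capacity_ge/feas.
  (* On a loop the flow is 0, and the capacity is either the default 0 or an upper bound of the
     feasible steps, hence at least [eps]. *)
  rewrite /capacity; case: xgetP => // b _ [_ ub].
  by apply: le_trans (ltW eps0) (ub _ _).
- move=> e; have -> : \sum_e' f e e' - \sum_e' f e' e =
      \sum_e' f0 e e' - \sum_e' f0 e' e.
    rewrite -!sumrB; apply: eq_bigr => e' _; rewrite /f eq_sym.
    by case: eqVneq => // ->; rewrite !subrr.
  (* After interchanging sums, a pair [p] of positive weight sends one unit out of [e] iff [e] is in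
     [p.1], and one unit into [e] iff [e] is in [p.2], since [g p] is a bijection. *)
  rewrite -!mulr_sumr exchange_big [in X in _ - X]exchange_big /= xw yw.
  congr (d * _ - d * _); apply: eq_bigr => p _; rewrite -mulr_sumr.
    congr (_ * _); rewrite (bigD1 (g p e)) //= /moved eqxx andbT big1 ?addr0 // => e'.
    by rewrite eq_sym => /negbTE ->; rewrite andbF.
  have [->|wp] := eqVneq (w p) 0; first by rewrite !mul0r.
  have [p1 p2] := wM p wp; have [inj im _] := gP p p1 p2; congr (_ * _).
  have [|ep] := boolP (e \in p.2); last first.
    rewrite big1 // => e' _; case: (boolP (moved p e' e)) => // /andP[e'p /eqP ge].
    by rewrite -im -ge imset_f in ep.
  rewrite -im => /imsetP[e1 e1p ->]; rewrite (bigD1 e1) //= /moved e1p eqxx /=.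
  rewrite big1 ?addr0 // => e' e'e1; case: (boolP (e' \in p.1)) => //= e'p.
  by case: eqP => // /inj e'E; rewrite e'E ?eqxx in e'e1.
Qed.
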